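(* Let $m\ge3$ be an odd integer and $n$ an integer with $2m<n$, and let $\lambda\ge\frac{n}{n-2m}$ be a constant. Let $\varphi:(0,1)\to(0,\infty)$ be continuous with $\lim_{r\to0^+}\varphi(r)=\infty$. Then there exists a $C^\infty$ positive solution $u$ of $$0\le-\Delta^m u\le u^\lambda\quad\text{in }\mathbb{R}^n\setminus\{0\}$$ such that $u(x)\neq O(\varphi(|x|))$ as $x\to 0$.
   Context: $\Delta^m$ is the $m$-fold iterated Laplacian. For positive functions, ''$u(x)\neq O(h(x))$ as $x\to0$'' means $\limsup_{x\to0} u(x)/h(x)=\infty$. *)

(* Defs.v *)
From Stdlib Require Import Reals.
From mathcomp Require Import all_boot.
Set Implicit Arguments. Unset Strict Implicit.

Open Scope R_scope.

Definition pt (n : nat) := 'I_n -> R.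

Definition rsum (n : nat) (f : 'I_n -> R) : R := \big[Rplus/0]_(i < n) f i.

Definition enorm (n : nat) (x : pt n) : R := sqrt (rsum (fun i => (x i) ^ 2)).

Definition upd (n : nat) (x : pt n) (i : 'I_n) (t : R) : pt n :=
  fun j => if j == i then t else x j.

Definition has_partial (n : nat) (D : pt n -> Prop) (i : 'I_n)
  (f g : pt n -> R) : Prop :=
  forall x, D x -> derivable_pt_lim (fun t => f (upd x i t)) (x i) (g x).

Definition cont_at (n : nat) (f : pt n -> R) (x : pt n) : Prop :=
  forall eps, 0 < eps -> exists delta, 0 < delta /\
    forall y, enorm (fun j => y j - x j) < delta -> Rabs (f y - f x) < eps.

(* F is a family of all iterated partial derivatives of f on D:
   F [::] = f, F (i :: s) = d/dx_i (F s), all continuous on D.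
   Existence of such a family on an open D is C^infinity smoothness. *)
Definition deriv_family (n : nat) (D : pt n -> Prop) (f : pt n -> R)
  (F : list 'I_n -> pt n -> R) : Prop :=
  (forall x, D x -> F nil x = f x) /\
  (forall s i, has_partial D i (F s) (F (i :: s))) /\
  (forall s x, D x -> cont_at (F s) x).

Definition smooth_on (n : nat) (D : pt n -> Prop) (f : pt n -> R) : Prop :=
  exists F, deriv_family D f F.

(* Laplacian on derivative families: (lapF F) s = d_s (Delta (F nil)),
   in particular (lapF F) [::] = sum_i d_i d_i f = Delta f, and lapF F is
   again a derivative family of Delta f. *)
Definition lapF (n : nat) (F : list 'I_n -> pt n -> R) : list 'I_n -> pt n -> R :=
  fun s x => rsum (fun i => F (s ++ [:: i; i]) x).

Definition polylap (n : nat) (m : nat) (F : list 'I_n -> pt n -> R) : pt n -> R :=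
  iter m (@lapF n) F nil.

Definition punctured (n : nat) (x : pt n) : Prop := 0 < enorm x.

(* Main.v *)
Require Import Defs.
From Stdlib Require Import Reals Lra Lia FunctionalExtensionality ClassicalEpsilon.
From Stdlib Require Import Ranalysis5.
From mathcomp Require Import all_boot.
From mathcomp Require Import Rstruct zify.
From Coquelicot Require Import Coquelicot.
Set Implicit Arguments. Unset Strict Implicit.
Open Scope R_scope.

(* Put k = n - 2m and w_(r,y)(x) = (r^2 + |x - y|^2)^(-1/2). The bubble w^k satisfies
   (-Delta)^m w^k = K r^(2m) w^(n+2m) with K >= 0, while |x|^(-k) and |x|^(-k-2) are
   m-polyharmonic off the origin. Take
     u = 1 + |x|^(-k) + |x|^(-k-2) + sum_j eps_j (w_j^k - |x|^(-k)),
   with eps_j growing geometrically and with centres y_j -> 0 and scales r_j << |y_j|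
   chosen so fast decreasing that the series converges together with all derivatives on
   compact subsets of the punctured space. Subtracting |x|^(-k) renormalises the (infinite)
   total mass; the negative part of the j-th term is at most eps_j k (|y_j| + r_j) |x|^(-k-1),
   which the two polyharmonic terms absorb, so u >= 1 everywhere. Near y_j one has
   u >= (E_j w_j)^k where eps_j = 2 E_j^k, and since n > k the power u^(n/k) >= (E_j w_j)^n
   beats the j-th source term, of size at most 2 K E_j^k w_j^n, by the factor 2^(-j-1);
   away from y_j the j-th source term is at most 2^(-j-1). *)

(** * Norm, derivative families and their Laplacians *)

Lemma rsum_add (n : nat) (a b : 'I_n -> R) :
  rsum (fun i => a i + b i) = rsum a + rsum b.
Proof. exact: big_split. Qed.

Lemma rsum_scal (n : nat) (c : R) (a : 'I_n -> R) :
  rsum (fun i => c * a i) = c * rsum a.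
Proof.
rewrite /rsum; elim/big_rec2: _ => [|i y1 y2 _ ->]; first by rewrite Rmult_0_r.
by rewrite Rmult_plus_distr_l.
Qed.

Lemma rsum_ext (n : nat) (a b : 'I_n -> R) :
  (forall i, a i = b i) -> rsum a = rsum b.
Proof. by move=> ab; apply: eq_bigr => i _. Qed.

Lemma rsum_const (n : nat) (c : R) : rsum (fun _ : 'I_n => c) = INR n * c.
Proof.
rewrite /rsum big_const card_ord; elim: n => [|n IH]; first by rewrite /= Rmult_0_l.
by rewrite iterS IH S_INR; lra.
Qed.

Lemma rsum_nonneg (n : nat) (a : 'I_n -> R) :
  (forall i, 0 <= a i) -> 0 <= rsum a.
Proof.
by move=> a0; rewrite /rsum; elim/big_rec: _ => [|i x _ x0]; [lra | have := a0 i; lra].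
Qed.

Lemma rsum_split (n : nat) (i : 'I_n) (a : 'I_n -> R) :
  rsum a = a i + \big[Rplus/0]_(j < n | j != i) a j.
Proof. by rewrite /rsum (bigD1 i). Qed.

Lemma rsum_ge_term (n : nat) (i : 'I_n) (a : 'I_n -> R) :
  (forall j, 0 <= a j) -> a i <= rsum a.
Proof.
move=> a0; rewrite (rsum_split i).
suff: 0 <= \big[Rplus/0]_(j < n | j != i) a j by lra.
by elim/big_rec: _ => [|j x _ x0]; [lra | have := a0 j; lra].
Qed.

Definition vsub (n : nat) (x y : pt n) : pt n := fun i => x i - y i.

Lemma enorm_ge0 (n : nat) (x : pt n) : 0 <= enorm x.
Proof. exact: sqrt_pos. Qed.

Lemma enorm_sqr (n : nat) (x : pt n) :
  rsum (fun i => x i ^ 2) = enorm x * enorm x.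
Proof. by rewrite sqrt_sqrt //; apply: rsum_nonneg => i; apply: pow2_ge_0. Qed.

Lemma coord_le_enorm (n : nat) (x : pt n) (i : 'I_n) : Rabs (x i) <= enorm x.
Proof.
rewrite -sqrt_Rsqr_abs; apply: sqrt_le_1_alt.
have -> : Rsqr (x i) = x i ^ 2 by rewrite /Rsqr /=; lra.
by apply: (rsum_ge_term i) => j; apply: pow2_ge_0.
Qed.

Lemma enorm_single (n : nat) (x : pt n) (i : 'I_n) :
  (forall j, j != i -> x j = 0) -> enorm x = Rabs (x i).
Proof.
move=> x0; rewrite /enorm (rsum_split i) big1 => [|j ji].
  by rewrite Rplus_0_r -sqrt_Rsqr_abs; congr sqrt; rewrite /Rsqr /=; lra.
by rewrite x0 //; lra.
Qed.

(** The form |a x + b y|^2 >= 0 is evaluated at (a, b) = (Y, -X). If one norm vanishes and S > X Y,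
    a suitable coefficient on that null vector makes the form equal to -1. *)
Lemma cauchy_schwarz (n : nat) (x y : pt n) :
  rsum (fun i => x i * y i) <= enorm x * enorm y.
Proof.
set X := enorm x; set Y := enorm y; set S := rsum _.
have X0 : 0 <= X by apply: enorm_ge0.
have Y0 : 0 <= Y by apply: enorm_ge0.
have Q (a b : R) : 0 <= a * a * (X * X) + (2 * (a * b) * S + b * b * (Y * Y)).
  rewrite -[X * X]enorm_sqr -[Y * Y]enorm_sqr -!rsum_scal -!rsum_add.
  apply: rsum_nonneg => i.
  have -> : a * a * x i ^ 2 + (2 * (a * b) * (x i * y i) + b * b * y i ^ 2)
            = (a * x i + b * y i) ^ 2 by ring.
  exact: pow2_ge_0.
case: (Rle_lt_dec S (X * Y)) => // XYS.
case: (Rle_lt_or_eq_dec 0 X X0) => [Xp|X00]; last first.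
  have := Q (- (Y * Y + 1) / (2 * S)) 1.
  have SP : 0 < S by nra.
  have -> : 2 * (- (Y * Y + 1) / (2 * S) * 1) * S = - (Y * Y + 1) by field; lra.
  by rewrite -X00; lra.
case: (Rle_lt_or_eq_dec 0 Y Y0) => [Yp|Y00]; last first.
  have := Q 1 (- (X * X + 1) / (2 * S)).
  have SP : 0 < S by nra.
  have -> : 2 * (1 * (- (X * X + 1) / (2 * S))) * S = - (X * X + 1) by field; lra.
  by rewrite -Y00; lra.
have := Q Y (- X).
have : 0 < X * Y by nra.
nra.
Qed.

Lemma enorm_triangle (n : nat) (x y : pt n) : enorm x <= enorm (vsub x y) + enorm y.
Proof.
have a0 := enorm_ge0 (vsub x y); have b0 := enorm_ge0 y; have c0 := enorm_ge0 x.
apply: Rsqr_incr_0; [|lra|lra]; rewrite /Rsqr -enorm_sqr.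
have := cauchy_schwarz (vsub x y) y.
have -> : rsum (fun i => x i ^ 2) = rsum (fun i => vsub x y i ^ 2)
   + (2 * rsum (fun i => vsub x y i * y i) + rsum (fun i => y i ^ 2)).
  by rewrite -rsum_scal -!rsum_add; apply: rsum_ext => i; rewrite /vsub; ring.
by rewrite !enorm_sqr; nra.
Qed.

Lemma enorm_vsubC (n : nat) (x y : pt n) : enorm (vsub x y) = enorm (vsub y x).
Proof. by rewrite /enorm; congr sqrt; apply: rsum_ext => i; rewrite /vsub; ring. Qed.

Lemma upd_same (n : nat) (x : pt n) (i : 'I_n) (t : R) : upd x i t i = t.
Proof. by rewrite /upd eqxx. Qed.

Lemma upd_id (n : nat) (x : pt n) (i : 'I_n) : upd x i (x i) = x.
Proof. by apply: functional_extensionality => j; rewrite /upd; case: eqP => [->|]. Qed.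

Lemma upd_upd (n : nat) (x : pt n) (i : 'I_n) (s t : R) :
  upd (upd x i s) i t = upd x i t.
Proof. by apply: functional_extensionality => j; rewrite /upd; case: eqP. Qed.

Lemma enorm_upd (n : nat) (x : pt n) (i : 'I_n) (s t : R) :
  enorm (fun j => upd x i s j - upd x i t j) = Rabs (s - t).
Proof.
rewrite (@enorm_single _ _ i) ?upd_same // => j ji.
by rewrite /upd (negbTE ji); ring.
Qed.

Lemma enorm_vsub_upd (n : nat) (x : pt n) (i : 'I_n) (t : R) :
  enorm (vsub (upd x i t) x) = Rabs (t - x i).
Proof. by rewrite -(enorm_upd x i t (x i)) upd_id. Qed.

Lemma enorm_0 (n : nat) : enorm (fun _ : 'I_n => 0) = 0.
Proof.
rewrite /enorm -[RHS]sqrt_0; congr sqrt.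
by rewrite -[RHS](Rmult_0_r (INR n)) -rsum_const; apply: rsum_ext => i; ring.
Qed.

Lemma enorm_vsubxx (n : nat) (x : pt n) : enorm (vsub x x) = 0.
Proof.
rewrite -[RHS](enorm_0 n); congr enorm.
by apply: functional_extensionality => i; rewrite /vsub; ring.
Qed.

(** * Open sets and families of iterated partial derivatives *)

Definition eopen (n : nat) (D : pt n -> Prop) : Prop :=
  forall x, D x -> exists d, 0 < d /\
    forall y, enorm (fun j => y j - x j) < d -> D y.

Lemma punctured_open (n : nat) : eopen (@punctured n).
Proof.
move=> x; rewrite /punctured => x0; exists (enorm x); split=> // y.
rewrite -/(vsub y x) => h; have := enorm_triangle x y.
by rewrite enorm_vsubC; lra.
Qed.

Lemma derivable_pt_lim_near (f g : R -> R) (a l d : R) :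
  0 < d -> (forall t, Rabs (t - a) < d -> f t = g t) ->
  derivable_pt_lim f a l -> derivable_pt_lim g a l.
Proof.
move=> d0 fg fl; apply/is_derive_Reals.
apply: (is_derive_ext_loc f); last by apply/is_derive_Reals.
exists (mkposreal d d0) => t; exact: fg.
Qed.

(** Induction on the multi-index: by openness the two partials of index s agree near x along the
    i-th line, hence so do their derivatives. Any family may thus be used to compute Laplacians. *)
Lemma deriv_family_unique (n : nat) (D : pt n -> Prop) (f : pt n -> R) F G :
  eopen D -> deriv_family D f F -> deriv_family D f G ->
  forall s x, D x -> F s x = G s x.
Proof.
move=> oD [F0 [F1 _]] [G0 [G1 _]]; elim=> [|i s IH] x Dx; first by rewrite F0 ?G0.
apply: (uniqueness_limite (fun t => G s (upd x i t)) (x i)); last exact: G1.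
have [d [d0 dD]] := oD x Dx.
apply: (derivable_pt_lim_near d0 _ (F1 s i x Dx)) => t td.
by apply: IH; apply: dD; rewrite -{2}(upd_id x i) enorm_upd.
Qed.

Lemma deriv_family_ext (n : nat) (D : pt n -> Prop) (f g : pt n -> R) F :
  (forall x, D x -> f x = g x) -> deriv_family D f F -> deriv_family D g F.
Proof. by move=> fg [F0 FF]; split=> // x Dx; rewrite F0 // fg. Qed.

Lemma cont_at_lin (n : nat) (a : R) (f g : pt n -> R) (x : pt n) :
  cont_at f x -> cont_at g x -> cont_at (fun y => a * f y + g y) x.
Proof.
move=> cf cg e e0.
have q0 : 0 < e / 2 / (Rabs a + 1) by apply: Rdiv_lt_0_compat; have := Rabs_pos a; lra.
have [d1 [d10 h1]] := cf _ q0.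
have [d2 [d20 h2]] := cg (e / 2) ltac:(lra).
exists (Rmin d1 d2); split; first exact: Rmin_pos.
move=> y yd; have := Rmin_l d1 d2; have := Rmin_r d1 d2 => m2 m1.
have H1 := h1 y ltac:(lra); have H2 := h2 y ltac:(lra).
have -> : a * f y + g y - (a * f x + g x) = a * (f y - f x) + (g y - g x) by ring.
apply: Rle_lt_trans (Rabs_triang _ _) _; rewrite Rabs_mult.
have a0 := Rabs_pos a; have b0 := Rabs_pos (f y - f x).
have : Rabs a * Rabs (f y - f x) <= e / 2; last by lra.
apply: Rle_trans (_ : (Rabs a + 1) * (e / 2 / (Rabs a + 1)) <= _); first by nra.
by right; field; lra.
Qed.

Lemma cont_at_const (n : nat) (c : R) (x : pt n) : cont_at (fun _ => c) x.
Proof. by move=> e e0; exists 1; split; [lra | move=> y _; rewrite Rminus_diag Rabs_R0]. Qed.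

Definition linF (n : nat) (a : R) (F G : list 'I_n -> pt n -> R) : list 'I_n -> pt n -> R :=
  fun s x => a * F s x + G s x.

Lemma deriv_family_lin (n : nat) (D : pt n -> Prop) (a : R) (f g : pt n -> R) F G :
  deriv_family D f F -> deriv_family D g G ->
  deriv_family D (fun x => a * f x + g x) (linF a F G).
Proof.
move=> [F0 [F1 F2]] [G0 [G1 G2]]; split=> [x Dx|]; first by rewrite /linF F0 ?G0.
split=> [s i x Dx|s x Dx]; last by apply: cont_at_lin; [apply: F2 | apply: G2].
apply: derivable_pt_lim_plus; last exact: G1.
by apply: derivable_pt_lim_scal; apply: F1.
Qed.

(** [lapF] puts its two indices at the innermost end of the list, so a further outer derivative acts
    term by term on the finite sum. *)
Lemma deriv_family_lapF (n : nat) (D : pt n -> Prop) (f : pt n -> R) F :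
  deriv_family D f F -> deriv_family D (lapF F nil) (lapF F).
Proof.
move=> [_ [F1 F2]]; split=> //; split=> [s i x Dx|s x Dx].
  rewrite /lapF /rsum; elim: (index_enum _) => [|j r IH].
    rewrite big_nil; apply: derivable_pt_lim_near (derivable_pt_lim_const 0 _);
      first exact: Rlt_0_1.
    by move=> t _; rewrite big_nil.
  rewrite big_cons.
  apply: derivable_pt_lim_near (derivable_pt_lim_plus _ _ _ _ _ (F1 _ i x Dx) IH);
    first exact: Rlt_0_1.
  by move=> t _; rewrite big_cons.
rewrite /lapF /rsum; elim: (index_enum _) => [|j r IH] e e0.
  by exists 1; split=> [|y _]; rewrite ?big_nil ?Rminus_diag ?Rabs_R0 //; lra.
have [d [d0 h]] := cont_at_lin 1 (F2 (s ++ [:: j; j]) x Dx) IH e0.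
by exists d; split=> // y /h; rewrite !big_cons !Rmult_1_l.
Qed.

Lemma lapF_lin (n : nat) (a : R) (F G : list 'I_n -> pt n -> R) :
  lapF (linF a F G) = linF a (lapF F) (lapF G).
Proof.
apply: functional_extensionality => s; apply: functional_extensionality => x.
by rewrite /lapF /linF rsum_add rsum_scal.
Qed.

Lemma iter_lapF_lin (n m : nat) (a : R) (F G : list 'I_n -> pt n -> R) :
  iter m (@lapF n) (linF a F G) = linF a (iter m (@lapF n) F) (iter m (@lapF n) G).
Proof. by elim: m => //= m ->; rewrite lapF_lin. Qed.

(** Encodes Delta^i f = g on [D] together with all derivatives. The family is existential so that
    identities can be chained and combined freely; [polylap_of_val] moves the result to any given
    family of f. *)
Definition polylap_of (n : nat) (D : pt n -> Prop) (i : nat) (f g : pt n -> R) : Prop :=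
  exists2 F, deriv_family D f F & deriv_family D g (iter i (@lapF n) F).

Lemma polylap_of_val (n : nat) (D : pt n -> Prop) (i : nat) (f g : pt n -> R) F :
  eopen D -> polylap_of D i f g -> deriv_family D f F -> deriv_family D g (iter i (@lapF n) F).
Proof.
move=> oD [G fG gG] fF.
have E : forall s x, D x -> iter i (@lapF n) F s x = iter i (@lapF n) G s x.
  elim: i {gG} => [|i IH] s x Dx; first exact: (deriv_family_unique oD fF fG).
  by rewrite /= /lapF; apply: rsum_ext => j; rewrite IH.
have [i0 _] := gG.
have : deriv_family D (iter i (@lapF n) F nil) (iter i (@lapF n) F).
  case: i {gG E i0} => [|i] /=; first by have [F0 FF] := fF; split.
  elim: i => [|i IH] /=; first exact: (deriv_family_lapF fF).
  exact: (deriv_family_lapF IH).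
by apply: deriv_family_ext => x Dx; rewrite E // i0.
Qed.

Lemma polylap_of_ext (n : nat) (D : pt n -> Prop) (i : nat) (f g f' g' : pt n -> R) :
  (forall x, D x -> f x = f' x) -> (forall x, D x -> g x = g' x) ->
  polylap_of D i f g -> polylap_of D i f' g'.
Proof.
move=> ff gg [F fF gF].
by exists F; [apply: deriv_family_ext fF | apply: deriv_family_ext gF].
Qed.

Lemma polylap_of_comp (n : nat) (D : pt n -> Prop) (i j : nat) (f g h : pt n -> R) :
  eopen D -> polylap_of D i f g -> polylap_of D j g h -> polylap_of D (j + i) f h.
Proof.
move=> oD [F fF gF] gh; exists F => //.
by rewrite iterD; apply: polylap_of_val gF.
Qed.

Lemma polylap_of_lin (n : nat) (D : pt n -> Prop) (i : nat) (a : R) (f g f' g' : pt n -> R) :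
  polylap_of D i f g -> polylap_of D i f' g' ->
  polylap_of D i (fun x => a * f x + f' x) (fun x => a * g x + g' x).
Proof.
move=> [F fF gF] [G fG gG]; exists (linF a F G); first exact: deriv_family_lin.
by rewrite iter_lapF_lin; apply: deriv_family_lin.
Qed.

(** * Powers of shifted radii *)

(* [Rad N] stands for [(r^2 + |z|^2)^(-N/2)]; these expressions are closed under
   the partial derivatives in [z]. *)
Inductive rexpr (n : nat) : Type :=
| Cst of R
| Coord of 'I_n
| Rad of nat
| Add of rexpr n & rexpr n
| Mul of rexpr n & rexpr n.
Arguments Cst {n}. Arguments Rad {n}.

Definition radius (n : nat) (r : R) (z : pt n) : R := sqrt (r * r + enorm z * enorm z).

Fixpoint eval (n : nat) (r : R) (z : pt n) (e : rexpr n) : R :=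
  match e with
  | Cst c => c
  | Coord i => z i
  | Rad N => (/ radius r z) ^ N
  | Add e1 e2 => eval r z e1 + eval r z e2
  | Mul e1 e2 => eval r z e1 * eval r z e2
  end.

Fixpoint diff (n : nat) (i : 'I_n) (e : rexpr n) : rexpr n :=
  match e with
  | Cst _ => Cst 0
  | Coord j => Cst (if j == i then 1 else 0)
  | Rad N => Mul (Cst (- INR N)) (Mul (Coord i) (Rad N.+2))
  | Add e1 e2 => Add (diff i e1) (diff i e2)
  | Mul e1 e2 => Add (Mul (diff i e1) e2) (Mul e1 (diff i e2))
  end.

(** The head of the list is differentiated last, in agreement with the indexing of
    [deriv_family]. *)
Definition evalF (n : nat) (r : R) (y : pt n) (e : rexpr n) : list 'I_n -> pt n -> R :=
  fun s x => eval r (vsub x y) (foldr (@diff n) e s).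

(** [radius r z] is the Euclidean norm of (r, z) in one more dimension; this is its triangle
    inequality, with the norm of the difference bounded by the sum of its two parts. *)
Lemma radius_lipschitz (n : nat) (r r' : R) (z z' : pt n) :
  radius r z <= radius r' z' + (Rabs (r - r') + enorm (vsub z z')).
Proof.
have b0 := enorm_ge0 z'; have a0 := enorm_ge0 z.
have v0 := enorm_ge0 (vsub z z'); have ab := enorm_triangle z z'.
rewrite /radius; set S := sqrt (r' * r' + _).
have S0 : 0 <= S by apply: sqrt_pos.
have SS : S * S = r' * r' + enorm z' * enorm z' by apply: sqrt_sqrt; nra.
have u0 := Rabs_pos (r - r').
have ru : Rabs r <= Rabs r' + Rabs (r - r').
  by have := Rabs_triang r' (r - r'); rewrite (_ : r' + (r - r') = r) //; ring.
have rr : r * r = Rabs r * Rabs r by rewrite -Rabs_mult Rabs_pos_eq //; nra.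
have rr' : r' * r' = Rabs r' * Rabs r' by rewrite -Rabs_mult Rabs_pos_eq //; nra.
have p0 := Rabs_pos r; have p0' := Rabs_pos r'.
have S1 : Rabs r' <= S by apply: Rsqr_incr_0 => //; rewrite /Rsqr SS rr'; nra.
have S2 : enorm z' <= S by apply: Rsqr_incr_0 => //; rewrite /Rsqr SS; nra.
rewrite -[X in _ <= X]sqrt_Rsqr; last by lra.
apply: sqrt_le_1_alt; rewrite /Rsqr rr.
have : Rabs r * Rabs r <= (Rabs r' + Rabs (r - r')) * (Rabs r' + Rabs (r - r')) by nra.
have : enorm z * enorm z <= (enorm (vsub z z') + enorm z') * (enorm (vsub z z') + enorm z') by nra.
nra.
Qed.

Lemma radius_dist (n : nat) (r r' : R) (z z' : pt n) :
  Rabs (radius r z - radius r' z') <= Rabs (r - r') + enorm (vsub z z').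
Proof.
have h1 := radius_lipschitz r r' z z'; have h2 := radius_lipschitz r' r z' z.
rewrite (Rabs_minus_sym r' r) (enorm_vsubC z' z) in h2.
by apply: Rabs_le; lra.
Qed.

Lemma radius_sqr (n : nat) (r : R) (z : pt n) :
  radius r z * radius r z = r * r + enorm z * enorm z.
Proof.
by apply: sqrt_sqrt; have := Rle_0_sqr r; have := Rle_0_sqr (enorm z); rewrite /Rsqr; lra.
Qed.

Lemma radius_0 (n : nat) (z : pt n) : radius 0 z = enorm z.
Proof. by rewrite /radius Rmult_0_l Rplus_0_l sqrt_square //; apply: enorm_ge0. Qed.

Lemma radius_ge_enorm (n : nat) (r : R) (z : pt n) : enorm z <= radius r z.
Proof.
apply: Rsqr_incr_0; [|exact: enorm_ge0|exact: sqrt_pos].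
by rewrite /Rsqr radius_sqr; nra.
Qed.

Lemma radius_ge_r (n : nat) (r : R) (z : pt n) : 0 <= r -> r <= radius r z.
Proof.
move=> r0; apply: Rsqr_incr_0 => //; last exact: sqrt_pos.
by rewrite /Rsqr radius_sqr; nra.
Qed.

Lemma derive_rad (n : nat) (r : R) (y x : pt n) (i : 'I_n) :
  0 < radius r (vsub x y) ->
  derivable_pt_lim (fun t => / radius r (vsub (upd x i t) y)) (x i)
    (- (x i - y i) * (/ radius r (vsub x y)) ^ 3).
Proof.
move=> p0.
pose C := \big[Rplus/0]_(j < n | j != i) vsub x y j ^ 2.
have E t : radius r (vsub (upd x i t) y) = sqrt (r * r + ((t - y i) ^ 2 + C)).
  rewrite /radius -enorm_sqr (rsum_split i) {1}/vsub upd_same.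
  congr (sqrt (_ + (_ + _))); apply: eq_bigr => j ji.
  by rewrite /vsub /upd (negbTE ji).
have Ex := E (x i); rewrite upd_id in Ex.
have P0 : 0 < r * r + ((x i - y i) ^ 2 + C).
  by apply: sqrt_lt_0_alt; rewrite sqrt_0 -Ex.
apply: (@derivable_pt_lim_near (fun t => / sqrt (r * r + ((t - y i) ^ 2 + C))) _ _ _ 1);
  [lra | by move=> t _; rewrite E |].
rewrite Ex; apply/is_derive_Reals.
have s0 := sqrt_lt_R0 _ P0.
have sq : (x i + - y i) * ((x i + - y i) * 1) = (x i - y i) ^ 2 by rewrite /=; ring.
auto_derive; rewrite sq; first by split=> //; split=> //; lra.
by field; lra.
Qed.

Lemma derive_eval (n : nat) (r : R) (y x : pt n) (i : 'I_n) (e : rexpr n) :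
  0 < radius r (vsub x y) ->
  derivable_pt_lim (fun t => eval r (vsub (upd x i t) y) e) (x i)
    (eval r (vsub x y) (diff i e)).
Proof.
move=> p0; elim: e => [c|j|N|e1 h1 e2 h2|e1 h1 e2 h2] /=.
- exact: derivable_pt_lim_const.
- rewrite /vsub /upd; case: eqP => [->|_]; last exact: derivable_pt_lim_const.
  rewrite -[1]Rminus_0_r; apply: derivable_pt_lim_minus; last exact: derivable_pt_lim_const.
  exact: derivable_pt_lim_id.
- have H := derivable_pt_lim_comp _ (fun u => u ^ N) _ _ _ (derive_rad i p0)
     (derivable_pt_lim_pow _ N).
  rewrite upd_id in H.
  have -> : - INR N * (vsub x y i * (/ radius r (vsub x y) *
     (/ radius r (vsub x y) * (/ radius r (vsub x y)) ^ N))) =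
     INR N * (/ radius r (vsub x y)) ^ N.-1 * (- (x i - y i) * (/ radius r (vsub x y)) ^ 3).
    by rewrite /vsub; case: (N) => [|M] /=; ring.
  exact: H.
- exact: derivable_pt_lim_plus.
- have := derivable_pt_lim_mult _ _ _ _ _ h1 h2.
  by rewrite upd_id.
Qed.

(* Used with balls [B d] around a point (continuity), and with sets of scales and centres
   of size at most [d] (convergence of the bubbles to [|x|^(-k)] on annuli). *)
Definition tends (T : Type) (B : R -> T -> Prop) (f g : T -> R) : Prop :=
  (exists C, forall t, B 1 t -> Rabs (g t) <= C) /\
  forall eta, 0 < eta -> exists d, 0 < d <= 1 /\ forall t, B d t -> Rabs (f t - g t) < eta.

Section Tends.
Context (T : Type) (B : R -> T -> Prop).
Hypothesis B_mono : forall d d' t, d <= d' -> B d t -> B d' t.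

Lemma tends_const (c : R) : tends B (fun _ => c) (fun _ => c).
Proof.
split; first by exists (Rabs c) => t _; lra.
by move=> e e0; exists 1; split; [lra | move=> t _; rewrite Rminus_diag Rabs_R0].
Qed.

Lemma tends_add f g f' g' :
  tends B f g -> tends B f' g' -> tends B (fun t => f t + f' t) (fun t => g t + g' t).
Proof.
move=> [[C hC] h] [[C' hC'] h']; split.
  exists (C + C') => t Bt; have := hC t Bt; have := hC' t Bt.
  by have := Rabs_triang (g t) (g' t); lra.
move=> e e0; have [d [d0 H]] := h (e / 2) ltac:(lra).
have [d' [d0' H']] := h' (e / 2) ltac:(lra).
have l := Rmin_l d d'; have l' := Rmin_r d d'.
exists (Rmin d d'); split; first by split; [apply: Rmin_pos; lra | lra].
move=> t Bt; have := H t (B_mono l Bt); have := H' t (B_mono l' Bt).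
have := Rabs_triang (f t - g t) (f' t - g' t).
by rewrite (_ : f t - g t + (f' t - g' t) = f t + f' t - (g t + g' t)); [lra | ring].
Qed.

Lemma tends_mul f g f' g' :
  tends B f g -> tends B f' g' -> tends B (fun t => f t * f' t) (fun t => g t * g' t).
Proof.
move=> [[C hC] h] [[C' hC'] h']; split.
  exists (C * C') => t Bt; rewrite Rabs_mult.
  by apply: Rmult_le_compat; [apply: Rabs_pos | apply: Rabs_pos | apply: hC | apply: hC'].
move=> e e0; set K := Rabs C + Rabs C' + 1.
have p := Rabs_pos C; have p' := Rabs_pos C'.
have K0 : 0 < K by rewrite /K; lra.
(* Errors below q <= 1 give a total of at most q (1 + |C| + |C'|) = q K <= e / 2. *)
pose q := Rmin 1 (e / (2 * K)).
have q0 : 0 < q by apply: Rmin_pos; [lra | apply: Rdiv_lt_0_compat; lra].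
have q1 : q <= 1 by apply: Rmin_l.
have qK : q * K <= e / 2.
  apply: Rle_trans (_ : e / (2 * K) * K <= _); last by right; field; lra.
  by apply: Rmult_le_compat_r; [lra | apply: Rmin_r].
have [d [d0 H]] := h q q0; have [d' [d0' H']] := h' q q0.
have l := Rmin_l d d'; have l' := Rmin_r d d'.
exists (Rmin d d'); split; first by split; [apply: Rmin_pos; lra | lra].
move=> t Bt; have B1 : B 1 t by apply: B_mono Bt; lra.
have a := H t (B_mono l Bt); have a' := H' t (B_mono l' Bt).
have b := hC t B1; have b' := hC' t B1.
have -> : f t * f' t - g t * g' t =
  (f t - g t) * (f' t - g' t) + ((f t - g t) * g' t + g t * (f' t - g' t)) by ring.
apply: Rle_lt_trans (Rabs_triang _ _) _.
apply: Rle_lt_trans (_ : _ <= _ + _) _; first exact: Rplus_le_compat_l (Rabs_triang _ _).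
rewrite !Rabs_mult; move: a a' b b'.
have := Rle_abs C; have := Rle_abs C'.
have := Rabs_pos (f t - g t); have := Rabs_pos (f' t - g' t).
have := Rabs_pos (g t); have := Rabs_pos (g' t).
move: (Rabs (f t - g t)) (Rabs (f' t - g' t)) (Rabs (g t)) (Rabs (g' t)) => u u' v v'.
move=> v0' v0 u0' u0 c' c uq uq' vC vC'.
have : u * u' <= q * 1 by apply: Rmult_le_compat; lra.
have : u * v' <= q * Rabs C' by apply: Rmult_le_compat; lra.
have : v * u' <= Rabs C * q by apply: Rmult_le_compat; lra.
by move: qK; rewrite /K; lra.
Qed.

Lemma tends_pow f g N : tends B f g -> tends B (fun t => f t ^ N) (fun t => g t ^ N).
Proof. by move=> fg; elim: N => [|N IH] /=; [apply: tends_const | apply: tends_mul]. Qed.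

Lemma tends_inv f g c : 0 < c -> (forall t, B 1 t -> c <= g t) ->
  tends B f g -> tends B (fun t => / f t) (fun t => / g t).
Proof.
move=> c0 gc [_ h]; split.
  exists (/ c) => t Bt; have := gc t Bt => gt.
  by rewrite Rabs_pos_eq; [apply: Rinv_le_contravar | left; apply: Rinv_0_lt_compat; lra].
move=> e e0; have cc : 0 < c * c * e by apply: Rmult_lt_0_compat => //; nra.
(* The threshold c / 2 keeps f above c / 2, so f g > c^2 / 2; the second threshold then bounds the
   difference of the inverses by e. *)
have [d [d0 H]] := h (Rmin (c / 2) (c * c * e / 2)) ltac:(apply: Rmin_pos; lra).
exists d; split=> // t Bt; have gt := gc t (B_mono (proj2 d0) Bt).
have := H t Bt; have := Rmin_l (c / 2) (c * c * e / 2).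
have := Rmin_r (c / 2) (c * c * e / 2) => m1 m2 ft.
have f0 : c / 2 < f t by move: (Rabs_def2 _ _ ft); lra.
have -> : / f t - / g t = - (f t - g t) * / (f t * g t) by field; lra.
have fg0 : c * c / 2 < f t * g t by nra.
rewrite Rabs_mult Rabs_Ropp (Rabs_pos_eq (/ _)); last by left; apply: Rinv_0_lt_compat; nra.
apply: (Rmult_lt_reg_r (f t * g t)); first by nra.
rewrite Rmult_assoc Rinv_l; last by nra.
nra.
Qed.

(** Structural induction on the expression: [radius_dist] controls the radius, and the lower bound
    [c] on the limiting radius allows its inversion in [Rad]. *)
Lemma tends_eval (n : nat) (r r' : T -> R) (z z' : T -> pt n) (C c : R) (e : rexpr n) :
  0 < c ->
  (forall d t, B d t -> Rabs (r t - r' t) <= d /\ enorm (vsub (z t) (z' t)) <= d) ->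
  (forall t, B 1 t ->
    enorm (z' t) <= C /\ radius (r' t) (z' t) <= C /\ c <= radius (r' t) (z' t)) ->
  tends B (fun t => eval (r t) (z t) e) (fun t => eval (r' t) (z' t) e).
Proof.
move=> c0 near bnd; elim: e => [b|j|N|e1 h1 e2 h2|e1 h1 e2 h2] /=.
- exact: tends_const.
- split.
    by exists C => t /bnd [h _]; apply: Rle_trans h; apply: coord_le_enorm.
  move=> e e0; have l := Rmin_l 1 (e / 2); have l' := Rmin_r 1 (e / 2).
  exists (Rmin 1 (e / 2)); split; first by split=> //; apply: Rmin_pos; lra.
  by move=> t /near [_ h]; have := coord_le_enorm (vsub (z t) (z' t)) j; rewrite {1}/vsub; lra.
- apply: tends_pow; apply: (tends_inv c0) => [t /bnd []|]; first by lra.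
  split.
    exists C => t /bnd [_ [h _]]; rewrite Rabs_pos_eq //; exact: sqrt_pos.
  move=> e e0; have l := Rmin_l 1 (e / 4); have l' := Rmin_r 1 (e / 4).
  exists (Rmin 1 (e / 4)); split; first by split=> //; apply: Rmin_pos; lra.
  by move=> t /near [h1 h2]; have := radius_dist (r t) (r' t) (z t) (z' t); lra.
- exact: tends_add.
- exact: tends_mul.
Qed.

End Tends.

Lemma cont_at_eval (n : nat) (r : R) (y x : pt n) (e : rexpr n) :
  0 < radius r (vsub x y) -> cont_at (fun x' => eval r (vsub x' y) e) x.
Proof.
move=> p0; pose B d x' := enorm (vsub x' x) < d.
have BM d d' t : d <= d' -> B d t -> B d' t by rewrite /B; lra.
have [] := @tends_eval _ B BM n (fun _ => r) (fun _ => r) (fun x' => vsub x' y)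
  (fun _ => vsub x y) (enorm (vsub x y) + radius r (vsub x y)) _ e p0.
- move=> d t Bt; rewrite Rminus_diag Rabs_R0.
  have -> : vsub (vsub t y) (vsub x y) = vsub t x.
    by apply: functional_extensionality => i; rewrite /vsub; ring.
  by have := enorm_ge0 (vsub t x); rewrite /B in Bt; lra.
- by move=> t _; have := enorm_ge0 (vsub x y); lra.
- by move=> _ h eps /h [d [[d0 _] hd]]; exists d.
Qed.

(** Covers the two cases in use: any centre with r > 0, and r = 0 with the centre at the origin. *)
Definition regular (n : nat) (r : R) (y : pt n) : Prop :=
  forall x, punctured x -> 0 < radius r (vsub x y).

Lemma deriv_family_eval (n : nat) (r : R) (y : pt n) (e : rexpr n) :
  regular r y -> deriv_family (@punctured n) (fun x => eval r (vsub x y) e) (evalF r y e).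
Proof.
move=> ry; split=> //; split=> [s i x px|s x px].
  exact: derive_eval (ry x px).
exact: cont_at_eval (ry x px).
Qed.

(** With w the inverse radius, the second derivatives sum to N (N+2) w^(N+4) |z|^2 - n N w^(N+2),
    and |z|^2 = w^(-2) - r^2. The trailing 0 fits the shape of [polylap_of_lin]. *)
Lemma lap_rad (n : nat) (r : R) (y : pt n) (N : nat) :
  regular r y ->
  polylap_of (@punctured n) 1 (fun x => eval r (vsub x y) (Rad N))
    (fun x => - (INR N * (INR n - INR N - 2)) * eval r (vsub x y) (Rad N.+2)
              + (- (INR N * (INR N + 2)) * (r * r) * eval r (vsub x y) (Rad N.+4) + 0)).
Proof.
move=> ry; exists (evalF r y (Rad N)); first exact: deriv_family_eval.
apply: deriv_family_ext (deriv_family_lapF (deriv_family_eval (Rad N) ry)) => x px.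
have p0 := ry x px; set z := vsub x y; set w := / radius r z.
rewrite /lapF /evalF.
have -> : rsum (fun i => eval r z (foldr (@diff n) (Rad N) ([::] ++ [:: i; i]))) =
   rsum (fun i => INR N * (INR N + 2) * w ^ N.+4 * z i ^ 2 + - INR N * w ^ N.+2).
  apply: rsum_ext => i; rewrite cat0s /foldr /diff eqxx /eval -/w.
  rewrite !S_INR /=; ring.
rewrite rsum_add rsum_scal rsum_const enorm_sqr.
have -> : enorm z * enorm z = radius r z * radius r z - r * r by rewrite radius_sqr; ring.
have -> : w ^ N.+2 = w ^ N.+4 * (radius r z * radius r z).
  by rewrite /w /=; field; rewrite /z; lra.
by rewrite /eval -/w -[(/ radius r z) ^ N.+2]/(w ^ N.+2) /w /=; field; rewrite /z; lra.
Qed.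

(** * Polyharmonic identities *)

Lemma polylap_of_0 (n : nat) (D : pt n -> Prop) (i : nat) :
  polylap_of D i (fun _ => 0) (fun _ => 0).
Proof.
have Z : deriv_family D (fun _ : pt n => 0) (fun _ _ => 0).
  split=> //; split=> [s j x _|s x _]; first exact: derivable_pt_lim_const.
  exact: cont_at_const.
exists (fun _ _ => 0) => //.
have -> : iter i (@lapF n) (fun _ _ => 0) = (fun _ _ => 0); last by [].
elim: i => //= i ->; apply: functional_extensionality => s.
by apply: functional_extensionality => x; rewrite /lapF rsum_const Rmult_0_r.
Qed.

(** The product N (N+2) ... (N+2j-2), with [j] factors in steps of two. *)
Fixpoint risefac (N j : nat) : R :=
  if j is j'.+1 then INR N * risefac N.+2 j' else 1.

Lemma risefacSr (N j : nat) : risefac N j.+1 = risefac N j * (INR N + 2 * INR j).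
Proof.
elim: j N => [|j IH] N; first by rewrite /=; ring.
rewrite -[LHS]/(INR N * risefac N.+2 j.+1) IH.
by rewrite -[risefac N j.+1]/(INR N * risefac N.+2 j) !S_INR; ring.
Qed.

Lemma risefac_ge0 (N j : nat) : 0 <= risefac N j.
Proof. by elim: j N => [|j IH] N /=; [lra | apply: Rmult_le_pos => //; apply: pos_INR]. Qed.

Definition rad_coef (i N : nat) (r : R) : R := (-1) ^ i * risefac N (i + i) * (r * r) ^ i.

(* The exponent [n - 2 i] is the conformal one: all the intermediate powers cancel. *)
Lemma polylap_rad (n : nat) (r : R) (y : pt n) (i N : nat) :
  regular r y -> (N + i.*2 = n)%N ->
  polylap_of (@punctured n) i (fun x => eval r (vsub x y) (Rad N))
    (fun x => rad_coef i N r * eval r (vsub x y) (Rad (N + 4 * i))).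
Proof.
move=> ry; move: i N.
(* Induction over pairs i, i+1: for N = n - 2(i+2), the Laplacian of w^N contains w^(N+2), conformal
   for i+1 Laplacians, and w^(N+4), conformal for i. *)
suff H i : (forall N, (N + i.*2 = n)%N -> polylap_of (@punctured n) i
      (fun x => eval r (vsub x y) (Rad N))
      (fun x => rad_coef i N r * eval r (vsub x y) (Rad (N + 4 * i)))) /\
    (forall N, (N + i.+1.*2 = n)%N -> polylap_of (@punctured n) i.+1
      (fun x => eval r (vsub x y) (Rad N))
      (fun x => rad_coef i.+1 N r * eval r (vsub x y) (Rad (N + 4 * i.+1)))).
  by move=> i N; apply: (proj1 (H i)).
elim: i => [|i [IH0 IH1]]; split.
- move=> N _; exists (evalF r y (Rad N)); first exact: deriv_family_eval.
  apply: deriv_family_ext (deriv_family_eval (Rad N) ry) => x _.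
  by rewrite /rad_coef muln0 !addn0; move: (eval r _ _) => E; rewrite /=; ring.
- move=> N Nn; apply: polylap_of_ext (lap_rad N ry) => // x _.
  have -> : INR n = INR N + 2 by rewrite -Nn plus_INR.
  have -> : (N + 4 * 1 = N.+4)%N by lia.
  move: (eval r _ (Rad _)) (eval r _ (Rad _)) => E1 E2.
  rewrite /rad_coef -[risefac N _]/(INR N * (INR N.+2 * 1)) !S_INR /=; ring.
- exact: IH1.
move=> N Nn.
have L1 := IH1 N.+2 ltac:(lia).
(* On w^(N+4) the hypothesis covers only i of the remaining i+1 Laplacians; the last one is computed
   by [lap_rad]. *)
have L2 := polylap_of_lin (rad_coef i N.+4 r) (lap_rad (N.+4 + 4 * i) ry) (polylap_of_0 _ 1).
have {}L2 := polylap_of_ext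
  (fun x _ => Rplus_0_r (rad_coef i N.+4 r * eval r (vsub x y) (Rad (N.+4 + 4 * i))))
  (fun _ _ => erefl) L2.
have {}L2 := polylap_of_comp (@punctured_open n) (IH0 N.+4 ltac:(lia)) L2.
rewrite add1n in L2.
have L3 := polylap_of_lin (- (INR N * (INR N + 2)) * (r * r)) L2 (polylap_of_0 _ i.+1).
have L4 := polylap_of_lin (- (INR N * (INR n - INR N - 2))) L1 L3.
have := polylap_of_comp (@punctured_open n) (lap_rad N ry) L4.
rewrite addn1; apply: polylap_of_ext => // x _.
have -> : (N.+4 + 4 * i = N + 4 * i.+1)%N by lia.
have -> : (N.+2 + 4 * i.+1 = (N + 4 * i.+1).+2)%N by lia.
have -> : (N + 4 * i.+2 = (N + 4 * i.+1).+4)%N by lia.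
have -> : INR n = INR N + 2 * INR i + 4.
  by rewrite -Nn -muln2 plus_INR mult_INR !S_INR /=; ring.
move: (eval r _ (Rad _)) (eval r _ (Rad _)) => E1 E2.
rewrite /rad_coef !addnS !addSn.
rewrite -[risefac N (i + i).+4]/(INR N * (INR N.+2 * risefac N.+4 (i + i).+2)).
rewrite -[risefac N.+2 (i + i).+2]/(INR N.+2 * risefac N.+4 (i + i).+1).
by rewrite !risefacSr !S_INR !plus_INR !S_INR /=; ring.
Qed.

(** * Series of derivative families *)

Definition seriesF (n : nat) (G : nat -> list 'I_n -> pt n -> R) : list 'I_n -> pt n -> R :=
  fun s x => Series (fun j => G j s x).

(** The tail after M is dominated by the sum of 2^(-i) over i > M, which is exactly 2^(-M). *)
Lemma series_geom_tail (a : nat -> R) (N : nat) :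
  (forall j, (N <= j)%N -> Rabs (a j) <= (1 / 2) ^ j) ->
  ex_series a /\ forall M, (N <= M)%N -> Rabs (Series a - sum_f_R0 a M) <= (1 / 2) ^ M.
Proof.
move=> ha.
have hh : Rabs (1 / 2) < 1 by rewrite Rabs_pos_eq; lra.
have gs : ex_series (pow (1 / 2)) := ex_series_geom _ hh.
have ea : ex_series a.
  apply/(ex_series_incr_n a N).
  apply: (@ex_series_le _ _ _ (fun k => (1 / 2) ^ (N + k))) => [k|].
    by apply: ha; lia.
  by apply/(ex_series_incr_n (pow (1 / 2)) N).
split=> // M NM; rewrite (Series_incr_n a M.+1) //; last by lia.
have -> : forall u v, u + v - u = v by move=> u v; ring.
have H : forall k, Rabs (a (M.+1 + k)%coq_nat) <= (1 / 2) ^ M.+1 * (1 / 2) ^ k.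
  by move=> k; rewrite -pow_add; apply: ha; lia.
have gs' : ex_series (fun k => (1 / 2) ^ M.+1 * (1 / 2) ^ k).
  exact: (ex_series_scal_l ((1 / 2) ^ M.+1) _ gs).
have ra : ex_series (fun k => Rabs (a (M.+1 + k)%coq_nat)).
  apply: ex_series_le gs' => k; apply: Rle_trans (H k).
  by rewrite /norm /= /abs /= Rabs_Rabsolu; lra.
apply: Rle_trans (Series_Rabs _ ra) _.
apply: Rle_trans (Series_le _ _ _ gs') _.
  by move=> k; split=> //; apply: Rabs_pos.
by rewrite Series_scal_l Series_geom //= ; right; field.
Qed.

Lemma half_pow_small (e : R) : 0 < e -> exists M0, forall M, (M0 <= M)%N -> (1 / 2) ^ M < e.
Proof.
move=> e0; have [M0 h] := pow_lt_1_zero (1 / 2) ltac:(rewrite Rabs_pos_eq; lra) e e0.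
by exists M0 => M M0M; apply: Rle_lt_trans (Rle_abs _) _; apply: h; lia.
Qed.

Section SeriesFamily.
Context (n : nat) (D : pt n -> Prop) (G : nat -> list 'I_n -> pt n -> R).
Hypothesis D_open : eopen D.
Hypothesis G_fam : forall j, deriv_family D (G j nil) (G j).
Hypothesis G_small : forall s x, D x -> exists d N, 0 < d /\ forall j y, (N <= j)%N ->
  enorm (vsub y x) < d -> Rabs (G j s y) <= (1 / 2) ^ j.

Lemma seriesF_is_series s x : D x -> is_series (fun j => G j s x) (seriesF G s x).
Proof.
move=> /(G_small s) [d [N [d0 h]]]; apply: Series_correct.
apply: (proj1 (@series_geom_tail _ N _)) => j Nj; apply: h => //.
by rewrite enorm_vsubxx.
Qed.

Lemma seriesF_cont s x : D x -> cont_at (seriesF G s) x.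
Proof.
move=> Dx e e0; have [d [N [d0 h]]] := G_small s Dx.
have [M0 hM0] := half_pow_small (e := e / 3) ltac:(lra).
pose M := maxn N M0.
have tail y : enorm (vsub y x) < d ->
    Rabs (seriesF G s y - sum_f_R0 (fun j => G j s y) M) < e / 3.
  move=> yd; apply: Rle_lt_trans (hM0 M (leq_maxr _ _)).
  by apply: (proj2 (@series_geom_tail _ N _)); [move=> j Nj; apply: h | apply: leq_maxl].
have cM : cont_at (fun y => sum_f_R0 (fun j => G j s y) M) x.
  elim: M {tail} => [|M IH] /=; first by have [_ [_ c]] := G_fam 0; apply: c.
  have [_ [_ c]] := G_fam M.+1.
  move=> a a0; have [b [b0 hb]] := cont_at_lin 1 IH (c s x Dx) a0.
  by exists b; split=> // y /hb; rewrite !Rmult_1_l.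
have [d' [d'0 h']] := cM (e / 3) ltac:(lra).
exists (Rmin d d'); split; first exact: Rmin_pos.
move=> y yd; have l := Rmin_l d d'; have l' := Rmin_r d d'.
have t1 := tail y ltac:(rewrite /vsub; lra).
have t2 := tail x ltac:(rewrite enorm_vsubxx; lra).
have t3 := h' y ltac:(lra).
move/Rabs_def2: t1 => t1; move/Rabs_def2: t2 => t2; move/Rabs_def2: t3 => t3.
by apply: Rabs_def1; lra.
Qed.

(** Termwise differentiation along each coordinate line, by uniform convergence of the
    differentiated series on an interval that stays in [D] and in the ball given by [G_small]. *)
Lemma deriv_family_series : deriv_family D (seriesF G nil) (seriesF G).
Proof.
split=> //; split=> [s i x Dx|s x Dx]; last exact: seriesF_cont.
have [d1 [d10 hD]] := D_open Dx.
have [d2 [N [d20 h2]]] := G_small (i :: s) Dx.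
have r0 : 0 < Rmin d1 d2 by apply: Rmin_pos.
have l1 := Rmin_l d1 d2; have l2 := Rmin_r d1 d2.
have near t : Rabs (t - x i) < Rmin d1 d2 -> enorm (vsub (upd x i t) x) < Rmin d1 d2.
  by rewrite enorm_vsub_upd.
have Dt t : Rabs (t - x i) < Rmin d1 d2 -> D (upd x i t).
  by move=> /near ht; apply: hD; rewrite -/(vsub (upd x i t) x); lra.
rewrite -[X in seriesF G (i :: s) X](upd_id x i).
apply: (@derivable_pt_lim_CVU
  (fun M t => sum_f_R0 (fun j => G j s (upd x i t)) M)
  (fun M t => sum_f_R0 (fun j => G j (i :: s) (upd x i t)) M)
  (fun t => seriesF G s (upd x i t)) (fun t => seriesF G (i :: s) (upd x i t))
  (x i) (x i) (mkposreal _ r0)).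
- by rewrite /Boule Rminus_diag Rabs_R0.
- move=> t M /Dt Dxt; elim: M => [|M IH] /=.
    have [_ [hp _]] := G_fam 0; have := hp s i _ Dxt; rewrite upd_same.
    by apply: derivable_pt_lim_near Rlt_0_1 _ => t' _; rewrite upd_upd.
  apply: derivable_pt_lim_plus => //.
  have [_ [hp _]] := G_fam M.+1; have := hp s i _ Dxt; rewrite upd_same.
  by apply: derivable_pt_lim_near Rlt_0_1 _ => t' _; rewrite upd_upd.
- move=> t /Dt Dxt; exact/is_series_Reals/seriesF_is_series.
- move=> e e0; have [M0 hM0] := half_pow_small e0.
  exists (maxn N M0) => M t /leP; rewrite geq_max => /andP[NM M0M] /near ht.
  apply: Rle_lt_trans (hM0 M M0M).
  apply: (proj2 (@series_geom_tail _ N _)) => // j Nj; apply: h2 => //; lra.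
- move=> t /Dt Dxt e e0; have [d [d0 hd]] := seriesF_cont (i :: s) Dxt e0.
  exists d; split=> // t' [_ ht']; apply: hd.
  by rewrite enorm_upd; exact: ht'.
Qed.

End SeriesFamily.

Lemma is_series_rsum (n : nat) (a : nat -> 'I_n -> R) (l : 'I_n -> R) :
  (forall i, is_series (fun j => a j i) (l i)) ->
  is_series (fun j => rsum (a j)) (rsum l).
Proof.
move=> al; rewrite /rsum; elim: (index_enum _) => [|i r IH].
  rewrite big_nil; apply/is_series_Reals => e e0; exists 0%N => M _.
  have -> : sum_f_R0 (fun j => \big[Rplus/0]_(i <- [::]) a j i) M = 0.
    by elim: M => [|M IH] /=; rewrite ?IH big_nil ?Rplus_0_r.
  by rewrite /R_dist Rminus_diag Rabs_R0.
rewrite big_cons; apply: is_series_ext (is_series_plus _ _ _ _ (al i) IH) => j.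
by rewrite big_cons.
Qed.

(** Each entry of an iterated [lapF] is a finite sum of entries of the family, so summing over j
    commutes with it by linearity. *)
Lemma is_series_iter_lapF (n m : nat) (G : nat -> list 'I_n -> pt n -> R) F (x : pt n) :
  (forall s, is_series (fun j => G j s x) (F s x)) ->
  forall s, is_series (fun j => iter m (@lapF n) (G j) s x) (iter m (@lapF n) F s x).
Proof.
move=> GF; elim: m => [|m IH] s //=.
by rewrite /lapF; apply: is_series_rsum.
Qed.

(** * Choice of the bubbles *)

Definition origin (n : nat) : pt n := fun _ => 0.

Lemma vsub_origin (n : nat) (x : pt n) : vsub x (@origin n) = x.
Proof. by apply: functional_extensionality => i; rewrite /vsub /origin Rminus_0_r. Qed.

Lemma regular_origin (n : nat) : regular 0 (@origin n).
Proof. by move=> x px; rewrite vsub_origin radius_0. Qed.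

Lemma regular_pos (n : nat) (r : R) (y : pt n) : 0 < r -> regular r y.
Proof. by move=> r0 x _; have := radius_ge_r (vsub x y) (Rlt_le _ _ r0); lra. Qed.

(** [tends] is applied to triples (r, y, x): r and |y| shrink while x ranges over a fixed annulus,
    which makes the convergence uniform in x. *)
Lemma eval_close (n : nat) (e : rexpr n) (rho eta : R) : 0 < rho -> 0 < eta ->
  exists d, 0 < d /\ forall r (y x : pt n), 0 <= r <= d -> enorm y <= d ->
    rho <= enorm x <= / rho -> Rabs (eval r (vsub x y) e - eval 0 x e) < eta.
Proof.
move=> rho0 eta0.
pose B d (t : R * pt n * pt n) := 0 <= t.1.1 <= d /\ enorm t.1.2 <= d /\
  rho <= enorm t.2 <= / rho.
have BM d d' t : d <= d' -> B d t -> B d' t by rewrite /B; lra.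
have [] := @tends_eval _ B BM n (fun t => t.1.1) (fun _ => 0) (fun t => vsub t.2 t.1.2)
  (fun t => t.2) (/ rho) rho e rho0.
- move=> d [[r y] x] [/= h1 [h2 _]]; rewrite Rminus_0_r Rabs_pos_eq; last by lra.
  rewrite enorm_vsubC.
  have -> : vsub x (vsub x y) = y; last by lra.
  by apply: functional_extensionality => i; rewrite /vsub; ring.
- by move=> [[r y] x] [/= _ [_ h]]; rewrite radius_0; lra.
move=> _ /(_ eta eta0) [d [[d0 _] h]]; exists d; split=> // r y x hr hy hx.
exact: (h (r, y, x)).
Qed.

(** [pickle] enumerates the multi-indices; bounding the code by [J] lets one d serve finitely many
    derivatives, while each fixed derivative is reached once [J] is large. *)
Lemma evalF_close (n : nat) (e : rexpr n) (rho eta : R) (J : nat) : 0 < rho -> 0 < eta ->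
  exists d, 0 < d /\ forall s r (y x : pt n), (pickle s < J)%N ->
    0 <= r <= d -> enorm y <= d -> rho <= enorm x <= / rho ->
    Rabs (evalF r y e s x - evalF 0 (@origin n) e s x) < eta.
Proof.
move=> rho0 eta0; elim: J => [|J [d [d0 h]]]; first by exists 1; split=> //; lra.
(* Decoding a list always succeeds, since [unpickle] on lists returns a [Some]; the other case is
   contradictory. *)
case E : (unpickle J : option (list 'I_n)) => [s0|//].
have [d' [d'0 h']] := eval_close (foldr (@diff n) e s0) rho0 eta0.
have l := Rmin_l d d'; have l' := Rmin_r d d'.
exists (Rmin d d'); split; first exact: Rmin_pos.
move=> s r y x; rewrite ltnS leq_eqVlt => /orP[/eqP sJ|sJ] hr hy hx.
  have -> : s = s0 by move: E; rewrite -sJ pickleK => -[].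
  by rewrite /evalF vsub_origin; apply: h'; lra.
by apply: h => //; lra.
Qed.

(** * Pointwise bounds for one bubble and choice of its parameters *)

(** Tangent-line bound for the convex function s -> s^(-k), by induction on k. *)
Lemma inv_pow_lower (s t : R) (k : nat) : 0 < s -> 0 <= t ->
  (/ s) ^ k - INR k * t * (/ s) ^ k.+1 <= (/ (s + t)) ^ k.
Proof.
move=> s0 t0; set w := / s; set v := / (s + t).
have w0 : 0 < w by apply: Rinv_0_lt_compat.
have v0 : 0 < v by apply: Rinv_0_lt_compat; lra.
have vw : v <= w by apply: Rinv_le_contravar; lra.
have wv : w - v <= t * (w * w).
  have -> : w - v = t * (w * v) by rewrite /w /v; field; lra.
  by apply: Rmult_le_compat_l => //; apply: Rmult_le_compat_l; lra.
elim: k => [|k IH]; first by rewrite /=; lra.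
have wk : 0 < w ^ k by apply: pow_lt.
have vk : v ^ k <= w ^ k by apply: pow_incr; lra.
have h1 : w * (w ^ k - v ^ k) <= w * (INR k * t * w ^ k.+1).
  by apply: Rmult_le_compat_l; lra.
have h2 : (w - v) * v ^ k <= t * (w * w) * w ^ k.
  by apply: Rmult_le_compat => //; [lra | apply: pow_le; lra].
by rewrite S_INR /= in h1 *; nra.
Qed.

Definition invrad (n : nat) (r : R) (y x : pt n) : R := / radius r (vsub x y).

(** The radius is at most |x| + |y| + r, so the tangent-line bound costs one extra power of 1/|x|,
    with a factor that tends to 0 with |y| + r. *)
Lemma invrad_lower (n : nat) (r : R) (y x : pt n) (k : nat) :
  0 <= r -> regular r y -> punctured x ->
  - (INR k * (enorm y + r)) * (/ enorm x) ^ k.+1 <= invrad r y x ^ k - (/ enorm x) ^ k.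
Proof.
move=> r0 ry px; have y0 := enorm_ge0 y.
have := @inv_pow_lower (enorm x) (enorm y + r) k px ltac:(lra).
have : (/ (enorm x + (enorm y + r))) ^ k <= invrad r y x ^ k; last by lra.
apply: pow_incr; split; first by left; apply: Rinv_0_lt_compat; rewrite /punctured in px; lra.
apply: Rinv_le_contravar; first exact: ry.
have := radius_lipschitz r 0 (vsub x y) x.
rewrite radius_0 Rminus_0_r (Rabs_pos_eq r) // (enorm_vsubC _ x).
have -> : vsub x (vsub x y) = y by apply: functional_extensionality => i; rewrite /vsub; ring.
lra.
Qed.

(** The hypothesis gives radius < |y|/4, hence |x| > 3|y|/4 > 3 radius, and the subtracted power is
    at most 3^(-k) <= 1/3 times w^k. *)
Lemma invrad_near (n : nat) (r : R) (y x : pt n) (k : nat) :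
  (0 < k)%N -> regular r y -> punctured x -> 0 < enorm y -> 4 / enorm y < invrad r y x ->
  invrad r y x ^ k / 2 <= invrad r y x ^ k - (/ enorm x) ^ k.
Proof.
move=> k0 ry px y0; have p0 := ry x px; rewrite /invrad.
have := radius_ge_enorm r (vsub x y); move: (radius r _) p0 => p p0 hp hw.
have hpy : p < enorm y / 4.
  rewrite -(Rinv_inv p) -[enorm y / 4]Rinv_inv.
  apply: Rinv_lt_contravar; first by apply: Rmult_lt_0_compat; apply: Rinv_0_lt_compat; lra.
  by have -> : / (enorm y / 4) = 4 / enorm y by field; lra.
have := enorm_triangle y x; rewrite enorm_vsubC => ht.
have h : (/ enorm x) ^ k <= (/ 3 * / p) ^ k.
  apply: pow_incr; split; first by left; apply: Rinv_0_lt_compat.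
  by rewrite -Rinv_mult; apply: Rinv_le_contravar; lra.
have pk : 0 < (/ p) ^ k by apply: pow_lt; apply: Rinv_0_lt_compat.
have h3 : (/ 3) ^ k <= / 3.
  case: k k0 {h pk} => // k _ /=.
  have : (/ 3) ^ k <= 1 by rewrite -[X in _ <= X](pow1 k); apply: pow_incr; lra.
  lra.
rewrite Rpow_mult_distr in h; nra.
Qed.

Lemma series_ge_term (a : nat -> R) (i : nat) :
  (forall j, 0 <= a j) -> ex_series a -> a i <= Series a.
Proof.
move=> a0 /Series_correct/is_series_Reals ea.
apply: Rle_trans (sum_incr _ i _ ea a0).
case: i => [|i] /=; first by lra.
have : 0 <= sum_f_R0 a i by apply: cond_pos_sum.
lra.
Qed.

(** Weights of total mass 1, used to share out u^lambda and |x|^(-k-1) among the bubbles. *)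
Lemma is_series_half : is_series (fun j => (1 / 2) ^ j.+1) 1.
Proof.
have hh : Rabs (1 / 2) < 1 by rewrite Rabs_pos_eq; lra.
have S1 : Series (fun j => (1 / 2) ^ j.+1) = 1.
  have -> : (fun j => (1 / 2) ^ j.+1) = (fun j => 1 / 2 * (1 / 2) ^ j) by [].
  by rewrite Series_scal_l Series_geom //; field.
rewrite -[X in is_series _ X]S1; apply: Series_correct.
exact: (ex_series_scal_l (1 / 2) _ (ex_series_geom _ hh)).
Qed.

(** The centre is fixed first, on a coordinate axis, then the scale, since the last two bounds
    involve |y|. The conditions serve in turn: scale small against the centre; centres tending to 0;
    convergence of the derivatives of code at most j on a growing annulus; a small negative part; a
    small source away from the centre, and a peak above j phi(|y|). *)
Lemma parameters_exist (m n k j : nat) (e : rexpr n) (i0 : 'I_n) (phi : R -> R) (K E eps : R) :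
  (0 < m)%N -> (0 < k)%N -> 0 <= K -> 1 <= E -> 0 < eps -> 
  exists p : R * pt n,
  [/\ 0 < p.1 < enorm p.2 / 4,
      enorm p.2 < / INR j.+1 /\ enorm p.2 < 1,
      forall s x, (pickle s <= j)%N -> / INR j.+1 <= enorm x <= INR j.+1 ->
        Rabs (eps * (evalF p.1 p.2 e s x - evalF 0 (@origin n) e s x)) <= (1 / 2) ^ j,
      eps * (INR k * (enorm p.2 + p.1)) <= (1 / 2) ^ j.+1 &
      eps * (K * (p.1 * p.1) ^ m * (4 / enorm p.2) ^ (k + 4 * m)) <= (1 / 2) ^ j.+1 /\
      INR j * phi (enorm p.2) < (E / p.1) ^ k].
Proof.
move=> m0 k0 K0 E1 eps0.
have j0 : 0 < INR j.+1 by apply: lt_0_INR; lia.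
have half i : 0 < (1 / 2) ^ i by apply: pow_lt; lra.
have [d [d0 hd]] := @evalF_close n e (/ INR j.+1) ((1 / 2) ^ j / eps) j.+1
  (Rinv_0_lt_compat _ j0) (Rdiv_lt_0_compat _ _ (half j) eps0).
have c0 : 0 < (1 / 2) ^ j.+1 / (2 * eps * (INR k + 1)).
  apply: Rdiv_lt_0_compat => //; have := pos_INR k; nra.
(* As r will be below a/4, |y| + r is at most 2a; the last bound on a then controls the negative
   part. *)
have [a [a0 ha]] : exists a, 0 < a /\ [/\ a < 1, a < / INR j.+1, a <= d
    & a <= (1 / 2) ^ j.+1 / (2 * eps * (INR k + 1))].
  exists (Rmin (Rmin (1 / 2) (/ INR j.+1 / 2)) (Rmin d ((1 / 2) ^ j.+1 / (2 * eps * (INR k + 1))))).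
  have q0 : 0 < / INR j.+1 by apply: Rinv_0_lt_compat.
  split; first by repeat apply: Rmin_pos; lra.
  set A := Rmin (1 / 2) _; set A' := Rmin d _.
  have := Rmin_l A A'; have := Rmin_r A A'.
  have := Rmin_l (1 / 2) (/ INR j.+1 / 2); have := Rmin_r (1 / 2) (/ INR j.+1 / 2).
  have := Rmin_l d ((1 / 2) ^ j.+1 / (2 * eps * (INR k + 1))).
  have := Rmin_r d ((1 / 2) ^ j.+1 / (2 * eps * (INR k + 1))).
  by rewrite -/A -/A'; split; lra.
pose y : pt n := fun i => if i == i0 then a else 0.
have ya : enorm y = a.
  rewrite (@enorm_single _ _ i0) /y ?eqxx ?Rabs_pos_eq //; first by lra.
  by move=> i /negbTE ->.
(* [b] is the source bound without its factor r^(2m). Since r^(2m) <= r for r < 1, the bound r <=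
   2^(-j-1)/(b+1) suffices. *)
set b := eps * K * (4 / a) ^ (k + 4 * m).
have b0 : 0 <= b.
  have : 0 < (4 / a) ^ (k + 4 * m) by apply: pow_lt; apply: Rdiv_lt_0_compat; lra.
  rewrite /b; have : 0 <= eps * K by nra.
  nra.
(* With r <= 1/g and E >= 1 one gets E/r >= g; the added 1 gives g <= g^k and strictness over j
   phi(a). *)
set g := Rabs (INR j * phi a) + 1.
have g0 : 1 <= g by rewrite /g; have := Rabs_pos (INR j * phi a); lra.
have [r [r0 hr]] : exists r, 0 < r /\ [/\ r < 1, r < a / 4, r <= (1 / 2) ^ j.+1 / (b + 1)
    & r <= / g].
  exists (Rmin (Rmin (1 / 2) (a / 8)) (Rmin ((1 / 2) ^ j.+1 / (b + 1)) (/ g))).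
  have q0 : 0 < / g by apply: Rinv_0_lt_compat; lra.
  have q1 : 0 < (1 / 2) ^ j.+1 / (b + 1) by apply: Rdiv_lt_0_compat => //; lra.
  split; first by repeat apply: Rmin_pos; lra.
  set A := Rmin (1 / 2) _; set A' := Rmin (_ / _) (/ g).
  have := Rmin_l A A'; have := Rmin_r A A'.
  have := Rmin_l (1 / 2) (a / 8); have := Rmin_r (1 / 2) (a / 8).
  have := Rmin_l ((1 / 2) ^ j.+1 / (b + 1)) (/ g).
  have := Rmin_r ((1 / 2) ^ j.+1 / (b + 1)) (/ g).
  by rewrite -/A -/A'; split; lra.
case: ha => a1 a2 a3 a4; case: hr => r1 r2 r3 r4.
exists (r, y); cbn [fst snd]; rewrite ya; split=> //.
- move=> s x sj hx; rewrite Rabs_mult Rabs_pos_eq; last by lra.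
  have := hd s r y x; rewrite ltnS sj ya Rinv_inv.
  move=> /(_ erefl ltac:(lra) ltac:(lra) hx) h.
  have -> : (1 / 2) ^ j = eps * ((1 / 2) ^ j / eps) by field; lra.
  by apply: Rmult_le_compat_l; lra.
- have k1 := pos_INR k.
  apply: Rle_trans
    (_ : eps * ((INR k + 1) * (2 * ((1 / 2) ^ j.+1 / (2 * eps * (INR k + 1))))) <= _).
    apply: Rmult_le_compat_l; first lra.
    by apply: Rmult_le_compat; lra.
  by right; field; lra.
split.
  have rm : (r * r) ^ m <= r.
    case: m m0 {b b0 r3} => // m _ /=.
    have : (r * r) ^ m <= 1 by rewrite -[X in _ <= X](pow1 m); apply: pow_incr; nra.
    have : 0 <= (r * r) ^ m by apply: pow_le; nra.
    move: (_ ^ m) => z z0 z1; have : r * z <= 1 * 1 by apply: Rmult_le_compat; lra.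
    nra.
  have -> : eps * (K * (r * r) ^ m * (4 / a) ^ (k + 4 * m)) = b * (r * r) ^ m by rewrite /b; ring.
  apply: Rle_trans (_ : (b + 1) * ((1 / 2) ^ j.+1 / (b + 1)) <= _); last by right; field; lra.
  apply: Rmult_le_compat; [lra| apply: pow_le; nra | lra | lra].
have gE : g <= E / r.
  rewrite -[g]Rinv_inv; apply: Rle_trans (_ : / r <= _); first exact: Rinv_le_contravar.
  rewrite /Rdiv -[X in X <= _]Rmult_1_l; apply: Rmult_le_compat_r => //.
  by left; apply: Rinv_0_lt_compat.
apply: Rlt_le_trans (_ : g ^ 1 <= _).
  by rewrite /g pow_1; have := Rle_abs (INR j * phi a); lra.
apply: Rle_trans (_ : g ^ k <= _); first by apply: Rle_pow => //; lia.
by apply: pow_incr; lra.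
Qed.

(** For v > 1, v^n = (v^k)^(n/k) <= u^(n/k) <= u^lambda. The case v <= 1 is separate because
    [Rpower] does not represent powers at base 0; there v^n <= 1 <= u^(n/k). *)
Lemma pow_le_Rpower (u v lambda : R) (k n : nat) :
  (0 < k)%N -> 1 <= u -> 0 <= v -> v ^ k <= u -> INR n / INR k <= lambda ->
  v ^ n <= Rpower u lambda.
Proof.
move=> k0 u1 v0 vu nk; have k0' : 0 < INR k by apply: lt_0_INR; lia.
have nk0 : 0 <= INR n / INR k by apply: Rdiv_le_0_compat => //; apply: pos_INR.
apply: Rle_trans (_ : Rpower u (INR n / INR k) <= _); last exact: Rle_Rpower.
case: (Rle_lt_dec v 1) => v1.
  apply: Rle_trans (_ : 1 <= _); first by rewrite -[X in _ <= X](pow1 n); apply: pow_incr.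
  by rewrite -[X in X <= _](Rpower_O u); [apply: Rle_Rpower | lra].
have -> : v ^ n = Rpower (v ^ k) (INR n / INR k).
  rewrite -!Rpower_pow ?Rpower_mult; try lra.
  by congr Rpower; field; lra.
by apply: Rle_Rpower_l => //; split=> //; apply: pow_lt; lra.
Qed.

(** * Iterated Laplacians of the building blocks *)

(** At r = 0 the factor r^(2i) in [polylap_rad] vanishes; the other m - i Laplacians act on 0. *)
Lemma polylap_rad_origin (n m i N : nat) : (N + i.*2 = n)%N -> (0 < i <= m)%N ->
  polylap_of (@punctured n) m (fun x => eval 0 (vsub x (@origin n)) (Rad N)) (fun _ => 0).
Proof.
move=> Nn /andP[i0 im]; rewrite -(subnK im).
apply: polylap_of_comp (@punctured_open n) _ (polylap_of_0 _ _).
apply: polylap_of_ext (polylap_rad (@regular_origin n) Nn) => // x _.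
by rewrite /rad_coef Rmult_0_l pow_i ?Rmult_0_r ?Rmult_0_l //; lia.
Qed.

Lemma polylap_one (n m : nat) : (0 < m)%N ->
  polylap_of (@punctured n) m (fun x => eval 0 (vsub x (@origin n)) (Rad 0)) (fun _ => 0).
Proof.
move=> m0; rewrite -(subnK m0).
apply: polylap_of_comp (@punctured_open n) _ (polylap_of_0 _ _).
apply: polylap_of_ext (lap_rad 0 (@regular_origin n)) => // x _.
by rewrite (_ : INR 0 = 0) //; ring.
Qed.

(** The zero family is appended only to scale by [eps] through [linF]. *)
Definition bumpF (n k : nat) (eps r : R) (y : pt n) : list 'I_n -> pt n -> R :=
  linF eps (linF (-1) (evalF 0 (@origin n) (Rad k)) (evalF r y (Rad k))) (fun _ _ => 0).

Lemma bumpFE (n k : nat) (eps r : R) (y : pt n) s x :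
  bumpF k eps r y s x = eps * (evalF r y (Rad k) s x - evalF 0 (@origin n) (Rad k) s x).
Proof. by rewrite /bumpF /linF; ring. Qed.

Lemma bumpF_nil (n k : nat) (eps r : R) (y x : pt n) :
  bumpF k eps r y nil x = eps * (invrad r y x ^ k - (/ enorm x) ^ k).
Proof. by rewrite bumpFE /evalF /= vsub_origin radius_0. Qed.

Lemma bumpF_family (n k : nat) (eps r : R) (y : pt n) : regular r y ->
  deriv_family (@punctured n) (bumpF k eps r y nil) (bumpF k eps r y).
Proof.
move=> ry.
apply: deriv_family_lin.
  by apply: deriv_family_lin; apply: deriv_family_eval => //; apply: regular_origin.
split=> //; split=> [s i x _|s x _]; first exact: derivable_pt_lim_const.
exact: cont_at_const.
Qed.

(** Oddness of m enters here: (-1)^m = -1 fixes the sign of the source. The subtracted |x|^(-k)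
    contributes nothing. *)
Lemma bumpF_polylap (n m k : nat) (eps r : R) (y x : pt n) :
  (k + m.*2 = n)%N -> (0 < m)%N -> odd m -> regular r y -> punctured x ->
  iter m (@lapF n) (bumpF k eps r y) nil x =
  - (eps * (risefac k (m + m) * (r * r) ^ m * invrad r y x ^ (k + 4 * m))).
Proof.
move=> kn m0 om ry px.
have P0 : polylap_of (@punctured n) m (fun x => eval 0 (vsub x (@origin n)) (Rad k)) (fun _ => 0).
  by apply: (polylap_rad_origin kn); rewrite m0 leqnn.
have L := polylap_of_lin eps (polylap_of_lin (-1) P0 (polylap_rad ry kn)) (polylap_of_0 _ m).
have [-> // _] := polylap_of_val (@punctured_open n) L (bumpF_family k eps ry).
rewrite /rad_coef /= -/(invrad r y x).
have -> : (-1) ^ m = -1.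
  by have := odd_double_half m; rewrite om => <-; rewrite -muln2 pow_add mulnC pow_1_even /=; ring.
ring.
Qed.

(** Amounts to 1 - w + w^2 >= 0; it lets |x|^(-k) + |x|^(-k-2) absorb the total negative part. *)
Lemma radial_bound (w : R) (k : nat) : 0 < w -> w ^ k.+1 <= w ^ k + w ^ k.+2.
Proof.
move=> w0 /=; have := pow_lt w k w0; move: (w ^ k) => a a0.
have : 0 <= a * (1 - w + w * w) by apply: Rmult_le_pos; nra.
lra.
Qed.

(** * Assembly of the solution and verification of its properties *)

Theorem theorem1p6 (m n : nat) (lambda : R) (phi : R -> R)
  (hm3 : (3 <= m)%nat) (hmodd : odd m) (hn : (2 * m < n)%nat)
  (hlam : INR n / (INR n - 2 * INR m) <= lambda)
  (hphi_cont : forall r, 0 < r < 1 -> continuity_pt phi r)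
  (hphi_pos : forall r, 0 < r < 1 -> 0 < phi r)
  (hphi_lim : forall M, exists delta, 0 < delta /\
      forall r, 0 < r < 1 -> r < delta -> M < phi r) :
  exists (u : pt n -> R) (F : list 'I_n -> pt n -> R),
    deriv_family (@punctured n) u F /\
    (forall x, punctured x -> 0 < u x) /\
    (forall x, punctured x ->
       0 <= - polylap m F x /\ - polylap m F x <= Rpower (u x) lambda) /\
    (forall M delta, 0 < delta -> exists x : pt n,
       0 < enorm x /\ enorm x < delta /\ enorm x < 1 /\
       M < u x / phi (enorm x)).
Proof.
have n0 : (0 < n)%N by lia.
pose i0 : 'I_n := Ordinal n0.
pose k := (n - m.*2)%N.
have k0 : (0 < k)%N by rewrite /k; lia.
have kn : (k + m.*2 = n)%N by rewrite /k; lia.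
have m0 : (0 < m)%N by lia.
have {}hlam : INR n / INR k <= lambda.
  by move: hlam; rewrite -{2}kn -muln2 plus_INR mult_INR (_ : INR 2 = 2) //
    (_ : INR k + INR m * 2 - 2 * INR m = INR k) //; ring.
pose K := risefac k (m + m).
have K0 : 0 <= K by apply: risefac_ge0.
(* The factor 4 times 2^j is tuned to give 2 K <= 2^(-j-1) E_j; the summand 1 gives E_j >= 1. *)
pose E j := 1 + 4 * K * 2 ^ j.
have E1 j : 1 <= E j by rewrite /E; have := pow_lt 2 j ltac:(lra); nra.
(* The factor 2 offsets the half lost in [invrad_near]. *)
pose eps j := 2 * E j ^ k.
have Ek j : 1 <= E j ^ k by apply: pow_R1_Rle.
have eps0 j : 0 < eps j by rewrite /eps; have := Ek j; lra.
have [p hp] : exists p : nat -> R * pt n, forall j,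
  [/\ 0 < (p j).1 < enorm (p j).2 / 4,
      enorm (p j).2 < / INR j.+1 /\ enorm (p j).2 < 1,
      forall s x, (pickle s <= j)%N -> / INR j.+1 <= enorm x <= INR j.+1 ->
        Rabs (eps j * (evalF (p j).1 (p j).2 (Rad k) s x -
                       evalF 0 (@origin n) (Rad k) s x)) <= (1 / 2) ^ j,
      eps j * (INR k * (enorm (p j).2 + (p j).1)) <= (1 / 2) ^ j.+1 &
      eps j * (K * ((p j).1 * (p j).1) ^ m * (4 / enorm (p j).2) ^ (k + 4 * m)) <= (1 / 2) ^ j.+1
      /\ INR j * phi (enorm (p j).2) < (E j / (p j).1) ^ k].
  have H j := constructive_indefinite_description _
    (@parameters_exist m n k j (Rad k) i0 phi K (E j) (eps j) m0 k0 K0 (E1 j) (eps0 j)).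
  by exists (fun j => proj1_sig (H j)) => j; case: (H j).
pose r j := (p j).1; pose y j := (p j).2.
have r0 j : 0 < r j by have [[]] := hp j.
have y0 j : 0 < enorm (y j) by have [[]] := hp j; rewrite -/(y j); lra.
have ry j : regular (r j) (y j) by apply: regular_pos.
pose G j := bumpF k (eps j) (r j) (y j).
have G_small s x : punctured x -> exists d N, 0 < d /\ forall j z, (N <= j)%N ->
    enorm (vsub z x) < d -> Rabs (G j s z) <= (1 / 2) ^ j.
  rewrite /punctured => x0.
  (* For j >= N the ball of radius |x|/2 about x lies in the annulus 1/(j+1) <= |z| <= j+1; the
     maximum with [pickle s] brings the derivative of index s under control. *)
  have [N hN] := INR_unbounded (2 / enorm x + 2 * enorm x).
  exists (enorm x / 2), (maxn (pickle s) N); split; first lra.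
  move=> j z; rewrite geq_max => /andP[sj Nj] zx.
  have jN : INR N <= INR j.+1 by apply: le_INR; lia.
  have q0 : 0 < 2 / enorm x by apply: Rdiv_lt_0_compat; lra.
  have t1 := enorm_triangle x z; have t2 := enorm_triangle z x.
  rewrite (enorm_vsubC x z) in t1.
  have [_ _ h _ _] := hp j; rewrite /G bumpFE; apply: h => //; split; last by lra.
  apply: Rle_trans (_ : / (2 / enorm x) <= _); first by apply: Rinv_le_contravar; lra.
  by have -> : / (2 / enorm x) = enorm x / 2; [field; lra | lra].
have G_fam j : deriv_family (@punctured n) (G j nil) (G j) by apply: bumpF_family.
pose H := linF 1 (evalF 0 (@origin n) (Rad k))
  (linF 1 (evalF 0 (@origin n) (Rad k.+2)) (evalF 0 (@origin n) (Rad 0))).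
have H_poly : deriv_family (@punctured n) (fun _ => 1 * 0 + (1 * 0 + 0)) (iter m (@lapF n) H).
  apply: (polylap_of_val (@punctured_open n)); last first.
    apply: deriv_family_lin; first exact: deriv_family_eval (@regular_origin n).
    by apply: deriv_family_lin; apply: deriv_family_eval (@regular_origin n).
  apply: polylap_of_lin; first by apply: (polylap_rad_origin kn); rewrite m0 leqnn.
  apply: polylap_of_lin; last exact: polylap_one.
  (* k + 2 = n - 2(m-1) is the conformal exponent for m - 1 Laplacians, and m - 1 > 0. *)
  by apply: (@polylap_rad_origin _ _ m.-1); lia.
pose F := linF 1 (seriesF G) H; pose u := F nil.
have sG := deriv_family_series (@punctured_open n) G_fam G_small.
have uF : deriv_family (@punctured n) u F.
  apply: deriv_family_lin => //; apply: deriv_family_lin.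
    exact: deriv_family_eval (@regular_origin n).
  by apply: deriv_family_lin; apply: deriv_family_eval (@regular_origin n).
have uE x : u x = Series (fun j => G j nil x) +
    ((/ enorm x) ^ k + ((/ enorm x) ^ k.+2 + 1)).
  by rewrite /u /F /H /linF /evalF /= vsub_origin radius_0 /seriesF; ring.
have W0 (x : pt n) : punctured x -> 0 < / enorm x by apply: Rinv_0_lt_compat.
have G_lower x j : punctured x -> 0 <= G j nil x + (1 / 2) ^ j.+1 * (/ enorm x) ^ k.+1.
  move=> px; rewrite /G bumpF_nil.
  have h := invrad_lower k (Rlt_le _ _ (r0 j)) (ry j) px.
  have h' := Rmult_le_compat_l _ _ _ (Rlt_le _ _ (eps0 j)) h.
  have [_ _ _ h3 _] := hp j; rewrite -/(y j) -/(r j) in h3.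
  have wk := pow_lt _ k.+1 (W0 x px).
  have := Rmult_le_compat_r _ _ _ (Rlt_le _ _ wk) h3.
  lra.
have u_lower x j : punctured x -> 1 + G j nil x <= u x /\ 1 <= u x.
  move=> px; set w := (/ enorm x) ^ k.+1.
  have sg := seriesF_is_series (s := nil) G_small px.
  (* Adding 2^(-i-1) |x|^(-k-1) to the i-th bump makes every term nonnegative, at total cost
     |x|^(-k-1), which [radial_bound] absorbs. *)
  have sh : is_series (fun j => (1 / 2) ^ j.+1 * w) w.
    by have := is_series_scal_r w _ _ is_series_half; rewrite Rmult_1_l.
  have st := is_series_plus _ _ _ _ sg sh.
  have t0 i : 0 <= plus (G i nil x) ((1 / 2) ^ i.+1 * w) by apply: G_lower.
  have := series_ge_term j t0 (ex_intro _ _ st).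
  rewrite (is_series_unique _ _ st) /plus /= -/(plus _ _).
  have := t0 j; rewrite /plus /= => t0j.
  have := radial_bound k (W0 x px); rewrite -/w uE /seriesF => rb.
  have w0 : 0 < w by apply: pow_lt; apply: W0.
  have := Rmult_le_pos _ _ (Rlt_le _ _ (pow_lt (1 / 2) j ltac:(lra))) (Rlt_le _ _ w0).
  rewrite /= in rb *; lra.
have u_near x j : punctured x -> 4 / enorm (y j) < invrad (r j) (y j) x ->
    (E j * invrad (r j) (y j) x) ^ k <= u x.
  move=> px h; have [hu _] := u_lower x j px.
  have := invrad_near k0 (ry j) px (y0 j) h; rewrite /G bumpF_nil in hu => hw.
  have := Rmult_le_compat_l _ _ _ (Rlt_le _ _ (eps0 j)) hw.
  by rewrite Rpow_mult_distr /eps in hu *; lra.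
exists u, F; split=> //; split; first by move=> x /(u_lower x 0%N)[]; lra.
split.
  move=> x px; rewrite /polylap /F iter_lapF_lin /linF.
  have [-> // _] := H_poly.
  have S1 := @is_series_iter_lapF n m G (seriesF G) x
    (fun s => seriesF_is_series (s := s) G_small px) nil.
  set S := iter m (@lapF n) (seriesF G) nil x in S1 *.
  pose f j := eps j * (K * (r j * r j) ^ m * invrad (r j) (y j) x ^ (k + 4 * m)).
  have {}S1 : is_series f (- S).
    apply: is_series_ext (is_series_opp _ _ S1) => j.
    by rewrite (bumpF_polylap _ kn m0 hmodd (ry j) px) /opp /= Ropp_involutive.
  have f0 j : 0 <= f j.
    apply: Rmult_le_pos; first exact: Rlt_le.
    apply: Rmult_le_pos; last by apply: pow_le; left; apply: Rinv_0_lt_compat; apply: ry.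
    apply: Rmult_le_pos => //; apply: pow_le.
    by have := r0 j; nra.
  have -> : - (1 * S + (1 * 0 + (1 * 0 + 0))) = - S by ring.
  rewrite -(is_series_unique _ _ S1).
  split.
    by apply: Rle_trans (series_ge_term 0%N f0 (ex_intro _ _ S1)); apply: f0.
  (* u^lambda is split with the weights 2^(-j-1), so that each source term is compared with its own
     share. *)
  have sP : is_series (fun j => (1 / 2) ^ j.+1 * Rpower (u x) lambda) (Rpower (u x) lambda).
    by have := is_series_scal_r (Rpower (u x) lambda) _ _ is_series_half; rewrite Rmult_1_l.
  rewrite -(is_series_unique _ _ sP); apply: Series_le (ex_intro _ _ sP) => j.
  split=> //; have [_ u1] := u_lower x j px.
  have hj : 0 < (1 / 2) ^ j.+1 by apply: pow_lt; lra.
  set w := invrad (r j) (y j) x in f f0 S1 *.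
  have w0 : 0 < w by apply: Rinv_0_lt_compat; apply: ry.
  (* Away from the centre the source term is at most 2^(-j-1) by the choice of scale, and u^lambda
     >= 1. *)
  case: (Rle_lt_dec w (4 / enorm (y j))) => hw.
    apply: Rle_trans (_ : (1 / 2) ^ j.+1 * 1 <= _).
      rewrite Rmult_1_r; have [_ _ _ _ [h _]] := hp j; apply: Rle_trans h.
      apply: Rmult_le_compat_l; first exact: Rlt_le.
      apply: Rmult_le_compat_l; last by apply: pow_incr; split; [exact: Rlt_le | exact: hw].
      by apply: Rmult_le_pos => //; apply: pow_le; have := r0 j; rewrite /r; nra.
    apply: Rmult_le_compat_l; first exact: Rlt_le.
    by rewrite -(pow1 n); apply: pow_le_Rpower hlam => //; rewrite ?pow1 //; lra.
  (* Near the centre, u >= (E_j w)^k gives u^lambda >= (E_j w)^n = E_j^k E_j^(2m) w^n, while the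
     source is at most 2 K E_j^k w^n. *)
  apply: Rle_trans (_ : (1 / 2) ^ j.+1 * (E j * w) ^ n <= _); last first.
    apply: Rmult_le_compat_l; first exact: Rlt_le.
    apply: pow_le_Rpower (u_near x j px hw) hlam => //.
    by apply: Rmult_le_pos; [have := E1 j; lra | exact: Rlt_le].
  have wn : 0 < w ^ n by apply: pow_lt.
  (* k + 4m = n + 2m and r_j w <= 1, so r_j^(2m) offsets the excess w^(2m). *)
  have rw : (r j * r j) ^ m * w ^ (k + 4 * m) <= w ^ n.
    have -> : (k + 4 * m = n + (m + m))%N by rewrite -kn; lia.
    have rw1 : r j * w <= 1.
      rewrite -(Rinv_r (radius (r j) (vsub x (y j)))); last by have := ry j x px; lra.
      by apply: Rmult_le_compat_r; [lra | apply: radius_ge_r; apply: Rlt_le].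
    have rw0 : 0 < r j * w by apply: Rmult_lt_0_compat.
    have : (r j * w) ^ m <= 1 by rewrite -[X in _ <= X](pow1 m); apply: pow_incr; lra.
    have := pow_lt _ m rw0; rewrite !pow_add !Rpow_mult_distr.
    move: (r j ^ m) (w ^ m) (w ^ n) wn => a b c c0 ab0 ab1.
    have : (a * b) * (a * b) <= 1 * 1 by apply: Rmult_le_compat; lra.
    nra.
  (* Of the 2m spare powers of E_j, a single one already covers 2 K against the weight 2^(-j-1). *)
  have Em : E j <= E j ^ m.*2.
    by rewrite -[X in X <= _]pow_1; apply: Rle_pow; [apply: E1 | lia].
  have KE : 2 * K <= (1 / 2) ^ j.+1 * E j.
    rewrite /E; have -> : (1 / 2) ^ j.+1 * (1 + 4 * K * 2 ^ j) =
       (1 / 2) ^ j.+1 + 2 * K * ((1 / 2) * 2) ^ j by rewrite Rpow_mult_distr /=; field.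
    by rewrite (_ : 1 / 2 * 2 = 1) ?pow1; lra.
  apply: Rle_trans (_ : E j ^ k * (2 * K) * w ^ n <= _).
    rewrite /f /eps.
    have -> : 2 * E j ^ k * (K * (r j * r j) ^ m * w ^ (k + 4 * m)) =
      E j ^ k * (2 * K) * ((r j * r j) ^ m * w ^ (k + 4 * m)) by ring.
    by apply: Rmult_le_compat_l => //; have := Ek j; nra.
  have -> : (E j * w) ^ n = E j ^ k * E j ^ m.*2 * w ^ n.
    by rewrite Rpow_mult_distr -pow_add (_ : (k + m.*2)%coq_nat = n).
  rewrite -[X in _ <= X]Rmult_assoc.
  apply: Rmult_le_compat_r; first exact: Rlt_le.
  have -> : (1 / 2) ^ j.+1 * (E j ^ k * E j ^ m.*2) =
    E j ^ k * ((1 / 2) ^ j.+1 * E j ^ m.*2) by ring.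
  apply: Rmult_le_compat_l; first by have := Ek j; lra.
  apply: Rle_trans KE _; apply: Rmult_le_compat_l => //; exact: Rlt_le.
move=> M delta d0.
(* With j above M and 1/delta, the centre y_j is the required point: |y_j| < 1/(j+1) and u(y_j) > j
   phi(|y_j|). *)
have [j hj] := INR_unbounded (Rmax M (/ delta)).
have j1 := Rmax_l M (/ delta); have j2 := Rmax_r M (/ delta).
have [[_ ra] [yj y1] _ _ [_ hphi]] := hp j.
rewrite -/(y j) -/(r j) in ra yj y1 hphi.
have dj : / INR j.+1 <= delta.
  rewrite -[delta]Rinv_inv; apply: Rinv_le_contravar; first exact: Rinv_0_lt_compat.
  by rewrite S_INR; lra.
exists (y j); split=> //; split; first lra; split=> //.
have ph := hphi_pos (enorm (y j)) (conj (y0 j) y1).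
apply: (Rmult_lt_reg_r (phi (enorm (y j)))) => //.
have -> : u (y j) / phi (enorm (y j)) * phi (enorm (y j)) = u (y j) by field; lra.
have wE : invrad (r j) (y j) (y j) = / r j.
  rewrite /invrad /radius enorm_vsubxx Rmult_0_l Rplus_0_r sqrt_square //; exact: Rlt_le.
(* At its own centre the bubble has w = 1/r_j > 4/|y_j|, so the near bound applies and gives u >=
   (E_j/r_j)^k. *)
have := u_near (y j) j (y0 j); rewrite wE => un.
apply: Rle_lt_trans (_ : INR j * phi (enorm (y j)) < _); first by apply: Rmult_le_compat_r; lra.
apply: Rlt_le_trans hphi (un _).
have yj0 := y0 j.
have -> : 4 / enorm (y j) = / (enorm (y j) / 4) by field; lra.
by apply: Rinv_lt_contravar => //; apply: Rmult_lt_0_compat => //; lra.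
Qed.
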